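(* Assume there exists a barrier digit $b$. Then $$(\underline{\alpha},\alpha^* )\cup\{\delta\log p_m\}\cup\{\overline{\alpha}\}\subset\Delta\mu.$$
   Context: Fix integers $d\ge 3$ and $m\ge d$ and a probability vector $\mathbf p=(p_0,\dots,p_m)$ with all $p_i>0$ which is regular, normalized so that $p_0\le p_m\le p_i$ for all $1\le i\le m-1$. Let $\mathcal A=\{0,\dots,m\}$; $\mathcal A^k$ is the set of words of length $k$, $\mathcal A^*=\bigcup_{k\ge0}\mathcal A^k$, $\mathcal A^{\mathbb N}$ the set of infinite sequences; $|\sigma|$ is the length of $\sigma$, $\sigma_j$ its $j$-th letter. Put $\delta=-1/\log d$ and $\xi=m/(d-1)$. Define $\pi(\sigma)=\sum_{i}\sigma_i d^{-i}$ for finite or infinite words. Let $\mu$ be the unique compactly supported Borel probability measure with $\mu(A)=\sum_{i=0}^m p_i\,\mu(dA-i)$ for all Borel $A$; its support is $[0,\xi]$. Let $a=1+\lfloor (m-d)/(d-1)\rfloor$, set $p_j=0$ for $j\notin\mathcal A$, and for $i\in\mathcal A$ let $M_i$ be the $(2a+1)\times(2a+1)$ matrix indexed by $\{-a,\dots,a\}^2$ with $M_i(k,l)=p_{k+i-ld}$; for $\sigma\in\mathcal A^k$ let $M(\sigma)=M_{\sigma_k}\cdots M_{\sigma_1}$. $\rho$ denotes spectral radius and $\tilde\rho(\mathcal M)=\limsup_{k}\left(\sup\{\rho(A_1\cdots A_k):A_i\in\mathcal M\}\right)^{1/k}$ the generalized spectral radius. Set $\underline{\alpha}=\delta\log\tilde\rho(M_0,\dots,M_m)$,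 $\alpha^*=\delta\log\inf\{\rho(M(\sigma))^{1/|\sigma|}:\sigma\in\mathcal A^*,\ \sigma_1\notin\{0,m\}\}$, $\overline{\alpha}=\delta\log p_0$. Local dimension: $\dim\mu(x)=\lim_{r\to0^+}\frac{\log\mu(B(x,r))}{\log r}$ when the limit exists, and $\Delta\mu=\{\dim\mu(x):x\in\operatorname{supp}\mu,\ \dim\mu(x)\text{ exists}\}$. A digit $b\in\mathcal A$ is a barrier digit if for every $\omega\in\mathcal A^{\mathbb N}$ with $\omega_1=b$ one has $\pi(\omega)-1<0<\xi<\pi(\omega)+1$. *)

(* Defs.v *)
From HB Require Import structures.
From mathcomp Require Import all_boot all_order all_algebra.
From mathcomp Require Import all_classical all_reals all_analysis.
From mathcomp Require Import complex.
Set Implicit Arguments. Unset Strict Implicit. Unset Printing Implicit Defensive.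
Import Order.TTheory GRing.Theory Num.Theory.
Import numFieldNormedType.Exports.
Local Open Scope classical_set_scope.
Local Open Scope ring_scope.

Section BernoulliConvolution.
Variable R : realType.

Definition delta (d : nat) : R := - (ln (d%:R : R))^-1.

Definition xi (d m : nat) : R := (m%:R : R) / ((d%:R : R) - 1).

Definition pz (m : nat) (p : nat -> R) (j : int) : R :=
  if (0 <= j) && (j <= m%:Z) then p `|j|%N else 0.

Definition adim (d m : nat) : nat := (1 + (m - d) %/ (d - 1))%N.

(* M_i : (2a+1)x(2a+1) matrix indexed by {-a,..,a}; row/column index k : 'I_(2a+1)
   stands for the integer k - a. *)
Definition Mi (d m : nat) (p : nat -> R) (i : nat) : 'M[R]_((adim d m).*2.+1) :=
  \matrix_(k, l) pz m p ((k%:Z - (adim d m)%:Z) + i%:Z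
                           - (l%:Z - (adim d m)%:Z) * d%:Z).

Definition Mword (d m : nat) (p : nat -> R) (s : seq nat) : 'M[R]_((adim d m).*2.+1) :=
  \prod_(i <- rev s) Mi d m p i.

Definition specrad (n : nat) (A : 'M[R]_n.+1) : R :=
  sup [set Normc.normc lam | lam in
        [set lam : R[i] | eigenvalue (map_mx (real_complex R) A) lam]].

Definition words (m k : nat) : set (seq nat) :=
  [set s | size s = k /\ all (fun i => (i <= m)%N) s].

Definition gen_specrad (d m : nat) (p : nat -> R) : R :=
  limn_sup (fun k : nat =>
    (sup [set specrad (Mword d m p s) | s in words m k]) `^ (k%:R^-1)).

Definition alpha_low (d m : nat) (p : nat -> R) : R :=
  delta d * ln (gen_specrad d m p).

Definition words_inner (m : nat) : set (seq nat) :=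
  [set s | (0 < size s)%N /\ all (fun i => (i <= m)%N) s /\
           head 0%N s != 0%N /\ head 0%N s != m].

Definition alpha_star (d m : nat) (p : nat -> R) : R :=
  delta d * ln (inf [set (specrad (Mword d m p s)) `^ ((size s)%:R^-1)
                    | s in words_inner m]).

Definition alpha_up (d : nat) (p : nat -> R) : R := delta d * ln (p 0%N).

(* pi(omega) = sum_{i>=1} omega_i d^{-i}; omega_1 is (w 0) *)
Definition pi_inf (d : nat) (w : nat -> nat) : R :=
  limn (series (fun i : nat => (w i)%:R / (d%:R : R) ^+ i.+1)).

Definition barrier_digit (d m b : nat) : Prop :=
  (b <= m)%N /\
  forall w : nat -> nat, (forall i, (w i <= m)%N) -> w 0%N = b ->
    pi_inf d w - 1 < 0 /\ 0 < xi d m /\ xi d m < pi_inf d w + 1.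

Definition self_similar (d m : nat) (p : nat -> R)
    (mu : set R -> \bar R) : Prop :=
  forall A : set R, measurable A ->
    mu A = (\sum_(i < m.+1) (p i)%:E
              * mu [set ((d%:R : R) * a - (i%:R : R))%R | a in A])%E.

Definition compactly_supported (mu : set R -> \bar R) : Prop :=
  exists K : set R, compact K /\ mu (~` K) = 0%E.

Definition supp (mu : set R -> \bar R) : set R :=
  [set x | forall r : R, 0 < r -> (0 < mu (ball x r))%E].

Definition locdim_is (mu : set R -> \bar R) (x alpha : R) : Prop :=
  (fun r : R => ln (fine (mu (ball x r))) / ln r) @ 0^'+ --> alpha.

Definition Delta (mu : set R -> \bar R) : set R :=
  [set alpha | exists2 x, supp mu x & locdim_is mu x alpha].

End BernoulliConvolution.

(* Main.v *)
Require Import Defs.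
From HB Require Import structures.
From mathcomp Require Import all_boot all_order all_algebra.
From mathcomp Require Import all_classical all_reals all_analysis.
From mathcomp Require Import measurable_realfun complex.
From mathcomp Require Import ring lra zify.
Import Order.TTheory GRing.Theory Num.Theory.
Import numFieldNormedType.Exports.
Local Open Scope classical_set_scope.
Local Open Scope ring_scope.
Set Implicit Arguments.
Unset Strict Implicit.
Unset Printing Implicit Defensive.

(** If the digit [b] is a barrier, then [m + 2 <= b + d] and [b + 2 <= d]; hence
    [xi < 2], the matrices are 3x3, and [M_b] has a single non-zero column, which
    is positive.  So when the tail of an expansion of [x] after [n] digits starts
    with [b], the mass of a ball of radius [r ~ d^-n] around [x] is, up to constants,
    the middle entry of [M(w_1 .. w_n)], and this entry is multiplicative over blocks
    that start with [b].

    Write [alpha = delta log t].  From [alpha < alpha^*] there is a word [u] with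
    [rho(M(u)) < t^|u|], and the blocks [b u^N] have middle entry below
    [t^(length)] for large [N]; from [alpha_low < alpha] there is a word [v] with
    [rho(M(v)) > t^|v|], and the blocks [b v^N y], for a suitable letter [y], have
    middle entry above [t^(length)].  Concatenating the two blocks greedily keeps
    the product of the entries comparable to [t^n], so that the resulting point has
    local dimension [alpha].  The endpoints [0] and [xi] have constant expansions
    and give [delta log p_0] and [delta log p_m]. *)

(** * Spectral radius and growth of powers *)

Section SpectralRadius.
Variables (R : realType) (n : nat).
Implicit Types (A B : 'M[R[i]]_n.+1) (z : R[i]).
Local Notation normc := (@Normc.normc R).

Lemma normc_ge0 z : 0 <= normc z.
Proof. by case: z => a b; exact: sqrtr_ge0. Qed.

Lemma normc_real (x : R) : normc (real_complex R x) = `|x|.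
Proof. by rewrite /= expr0n /= addr0 sqrtr_sqr. Qed.

Lemma normcX z k : normc (z ^+ k) = normc z ^+ k.
Proof.
elim: k => [|k IH]; first by rewrite !expr0 Normc.normc1.
by rewrite !exprS Normc.normcM IH.
Qed.

Lemma normc_sum (I : Type) (s : seq I) (F : I -> R[i]) :
  normc (\sum_(i <- s) F i) <= \sum_(i <- s) normc (F i).
Proof.
elim: s => [|i s IH]; first by rewrite !big_nil Normc.normc0.
rewrite !big_cons; apply: le_trans (le_normcD _ _) _.
by rewrite lerD2l.
Qed.

Definition mxnorm1 A : R := \sum_i \sum_j normc (A i j).

Lemma mxnorm1_ge0 A : 0 <= mxnorm1 A.
Proof. by apply: sumr_ge0 => i _; apply: sumr_ge0 => j _; exact: normc_ge0. Qed.

Lemma mxnorm1D A B : mxnorm1 (A + B) <= mxnorm1 A + mxnorm1 B.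
Proof.
rewrite /mxnorm1 -big_split /=; apply: ler_sum => i _.
rewrite -big_split /=; apply: ler_sum => j _.
by rewrite mxE; exact: le_normcD.
Qed.

Lemma mxnorm1Z z A : mxnorm1 (z *: A) = normc z * mxnorm1 A.
Proof.
rewrite /mxnorm1 mulr_sumr; apply: eq_bigr => i _.
rewrite mulr_sumr; apply: eq_bigr => j _.
by rewrite mxE Normc.normcM.
Qed.

Lemma mxnorm1_map (A : 'M[R]_n.+1) :
  mxnorm1 (map_mx (real_complex R) A) = \sum_i \sum_j `|A i j|.
Proof.
by apply: eq_bigr => i _; apply: eq_bigr => j _; rewrite mxE normc_real.
Qed.

Lemma le_entry_mxnorm1 A i j : normc (A i j) <= mxnorm1 A.
Proof.
rewrite /mxnorm1 (bigD1 i) //= (bigD1 j) //= -addrA lerDl addr_ge0 //.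
  by apply: sumr_ge0 => k _; exact: normc_ge0.
by apply: sumr_ge0 => k _; apply: sumr_ge0 => l _; exact: normc_ge0.
Qed.

(** A left eigenvector [v] satisfies [v A^k = z^k v]; comparing l1 norms of both sides and dividing
    by that of [v] gives the bound. *)
Lemma eigenvalue_pow_le A z k :
  eigenvalue A z -> normc z ^+ k <= mxnorm1 (A ^+ k).
Proof.
move=> /eigenvalueP [v vA v0].
have vAk : v *m A ^+ k = z ^+ k *: v.
  elim: k => [|k IH]; first by rewrite !expr0 mulmx1 scale1r.
  by rewrite exprSr mulmxA IH -scalemxAl vA scalerA -exprSr.
set N := \sum_j normc (v 0 j).
have N0 : 0 < N.
  rewrite lt_def sumr_ge0 ?andbT; last by move=> j _; exact: normc_ge0.
  apply: contra v0; rewrite psumr_eq0; last by move=> j _; exact: normc_ge0.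
  move=> /allP H; apply/eqP/rowP => j; rewrite mxE.
  by apply: Normc.eq0_normc; apply/eqP; apply: H; rewrite mem_index_enum.
rewrite -(ler_pM2r N0) -normcX /N mulr_sumr.
have -> : \sum_j normc (z ^+ k) * normc (v 0 j)
        = \sum_j normc ((v *m A ^+ k) 0 j).
  by apply: eq_bigr => j _; rewrite vAk [in RHS]mxE Normc.normcM.
apply: (@le_trans _ _ (\sum_j \sum_i normc (v 0 i) * normc ((A ^+ k) i j))).
  apply: ler_sum => j _; rewrite mxE.
  apply: le_trans (normc_sum _ _) _.
  by apply: ler_sum => i _; rewrite Normc.normcM.
rewrite exchange_big /= /mxnorm1 mulr_suml; apply: ler_sum => i _.
rewrite mulr_suml; apply: ler_sum => j _.
rewrite mulrC ler_wpM2l ?normc_ge0 //.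
rewrite (bigD1 i) //= lerDl; apply: sumr_ge0 => l _; exact: normc_ge0.
Qed.

Lemma eigenvalue_le_specrad (A : 'M[R]_n.+1) z :
  eigenvalue (map_mx (real_complex R) A) z -> normc z <= specrad A.
Proof.
move=> Az; apply: ub_le_sup; last by exists z.
exists (mxnorm1 (map_mx (real_complex R) A)) => _ [y Ay <-].
by have := @eigenvalue_pow_le _ _ 1 Ay; rewrite !expr1.
Qed.

(* [y N := A^N B1] satisfies [y (N+1) - z y N = A^N (A - z) B1]; a first-order
   recurrence with ratio of modulus less than [s] preserves growth [O(s^N)]. *)
Lemma geometric_bound_prod A (zs : seq R[i]) (r s : R) B (C : R) :
    0 <= r < s -> (forall z, z \in zs -> normc z <= r) ->
    (forall N, mxnorm1 (A ^+ N * (\prod_(z <- zs) (A - z%:M)) * B) <= C * s ^+ N) ->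
  exists C', forall N, mxnorm1 (A ^+ N * B) <= C' * s ^+ N.
Proof.
move=> /andP[r0 rs]; have s0 : 0 < s by exact: le_lt_trans rs.
elim: zs C => [|z zs IH] C zr H.
  by exists C => N; have := H N; rewrite big_nil mulr1.
set B1 := (\prod_(y <- zs) (A - y%:M)) * B.
(* The first term covers [N = 0]; the second gives [C + r C' <= s C'], which closes the
   induction. *)
pose C' := Num.max (mxnorm1 B1) (C / (s - r)).
apply: (IH C'); first by move=> y yz; apply: zr; rewrite inE yz orbT.
have sr : 0 < s - r by rewrite subr_gt0.
have CC' : C <= C' * (s - r).
  by rewrite -ler_pdivrMr // le_max lexx orbT.
have C'0 : 0 <= C' by rewrite le_max mxnorm1_ge0.
elim=> [|N IHN].
  by rewrite !expr0 mul1r mulr1 -/B1 le_max lexx.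
have -> : A ^+ N.+1 * \prod_(y <- zs) (A - y%:M) * B
    = A ^+ N * (\prod_(y <- z :: zs) (A - y%:M)) * B
      + z *: (A ^+ N * \prod_(y <- zs) (A - y%:M) * B).
  rewrite big_cons exprSr -!mulrA mulrBl mulrBr -[z%:M * _]/(z%:M *m _).
  by rewrite mul_scalar_mx -!scalerAr subrK.
apply: le_trans (mxnorm1D _ _) _.
apply: le_trans (lerD (H N) (lexx _)) _.
rewrite mxnorm1Z.
have zr1 : normc z <= r by apply: zr; rewrite inE eqxx.
have h1 : normc z * mxnorm1 (A ^+ N * \prod_(y <- zs) (A - y%:M) * B)
          <= r * (C' * s ^+ N).
  by apply: ler_pM => //; [exact: normc_ge0 | exact: mxnorm1_ge0].
apply: le_trans (lerD (lexx _) h1) _.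
rewrite exprS !mulrA -mulrDl ler_wpM2r ?exprn_ge0 ?(ltW s0) //.
by apply: le_trans (lerD CC' (lexx _)) _; lra.
Qed.

(** By Cayley-Hamilton the product of [A - z] over the roots of the characteristic polynomial
    vanishes, so [geometric_bound_prod] applies with constant [0] and strips off the factors. *)
Lemma specrad_pow_bound (A : 'M[R]_n.+1) (s : R) :
    0 < s -> specrad A < s ->
  exists C, forall N i j, `|(A ^+ N) i j| <= C * s ^+ N.
Proof.
move=> s0 As; set Ac := map_mx (real_complex R) A.
have [zs Ezs] := closed_field_poly_normal (char_poly Ac).
move: Ezs; rewrite (monicP (char_poly_monic Ac)) scale1r => Ezs.
pose r := Num.max 0 (specrad A).
have zr z : z \in zs -> normc z <= r.
  move=> zzs; rewrite le_max eigenvalue_le_specrad ?orbT //.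
  by rewrite eigenvalue_root_char Ezs root_prod_XsubC.
have P0 : \prod_(z <- zs) (Ac - z%:M) = 0.
  have := Cayley_Hamilton Ac; rewrite Ezs rmorph_prod /= => <-.
  by apply: eq_bigr => z _; rewrite rmorphB /= horner_mx_X horner_mx_C.
have rs : 0 <= r < s by rewrite le_max lexx /= gt_max s0.
have [|C HC] := @geometric_bound_prod Ac zs r s 1 0 rs zr.
  move=> N; rewrite P0 mulr0 mul0r mul0r /mxnorm1 big1 // => i _.
  by rewrite big1 // => j _; rewrite mxE Normc.normc0.
exists C => N i j; have := HC N; rewrite mulr1; apply: le_trans.
have -> : Ac ^+ N = map_mx (real_complex R) (A ^+ N) by rewrite rmorphXn.
by apply: le_trans (le_entry_mxnorm1 _ i j); rewrite mxE normc_real.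
Qed.

Lemma lt_specrad_pow (A : 'M[R]_n.+1) (s : R) N :
  0 <= s -> s < specrad A -> s ^+ N <= \sum_i \sum_j `|(A ^+ N) i j|.
Proof.
move=> s0 As.
set S := [set normc z | z in
            [set z | eigenvalue (map_mx (real_complex R) A) z]].
(* The supremum of the empty set is [0] by default, which [0 <= s < specrad A] excludes. *)
have S0 : S !=set0.
  apply/set0P/negP => /eqP SE; move: As.
  by rewrite /specrad -/S SE sup0 ltNge s0.
have [_ [z Az <-] sz] := sup_gt S0 As.
rewrite -mxnorm1_map rmorphXn /=.
apply: le_trans (@eigenvalue_pow_le _ _ N Az).
by rewrite lerXn2r ?nnegrE ?normc_ge0 // ltW.
Qed.

Lemma specrad_le_sum (A : 'M[R]_n.+1) : specrad A <= \sum_i \sum_j `|A i j|.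
Proof.
rewrite leNgt; apply/negP => H.
have S0 : 0 <= \sum_i \sum_j `|A i j|.
  by apply: sumr_ge0 => i _; apply: sumr_ge0 => j _.
pose S := \sum_i \sum_j `|A i j|.
have [h1 h2] : S < (S + specrad A) / 2 /\ (S + specrad A) / 2 < specrad A.
  by rewrite /S; split; lra.
have := @lt_specrad_pow A _ 1 (le_trans S0 (ltW h1)) h2.
by rewrite !expr1 leNgt h1.
Qed.

End SpectralRadius.

(** * Mass of balls *)

Section BallMass.
Variables (R : realType) (d m : nat) (p : nat -> R) (mu : probability R R).
Hypothesis hd : (3 <= d)%N.
Hypothesis hpos : forall i, (i <= m)%N -> 0 < p i.
Hypothesis hcpt : compactly_supported mu.
Hypothesis hss : self_similar d m p mu.

Definition mass (x r : R) : R := fine (mu (ball x r)).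

Lemma mass_fin x r : mu (ball x r) = (mass x r)%:E.
Proof. by rewrite fineK // fin_num_measure //; exact: measurable_ball. Qed.

Lemma mass_ge0 x r : 0 <= mass x r.
Proof. by rewrite -lee_fin -mass_fin measure_ge0. Qed.

Lemma mass_le1 x r : mass x r <= 1.
Proof. by rewrite -lee_fin -mass_fin probability_le1 //; exact: measurable_ball. Qed.

Lemma mass_mono x y r s : `|x - y| + r <= s -> mass x r <= mass y s.
Proof.
move=> H; rewrite -lee_fin -!mass_fin le_measure ?inE //;
  try exact: measurable_ball.
move=> z; rewrite -!ball_normE /= => zx.
rewrite (le_lt_trans (ler_distD x _ _)) // distrC.
by rewrite (lt_le_trans _ H) // ltrD2l.
Qed.

Lemma mass_self_similar x r :
  mass x r = \sum_(i < m.+1) p i * mass (d%:R * x - i%:R) (d%:R * r).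
Proof.
have d0 : 0 < d%:R :> R by rewrite ltr0n (leq_trans _ hd).
apply: EFin_inj; rewrite -mass_fin hss; last exact: measurable_ball.
rewrite -sumEFin; apply: eq_bigr => i _.
rewrite EFinM -mass_fin; congr (_ * mu _)%E.
apply/seteqP; split=> [_ [y + <-]|y].
  rewrite -!ball_normE /= => yx.
  have -> : d%:R * x - i%:R - (d%:R * y - i%:R) = d%:R * (x - y) by ring.
  by rewrite normrM ger0_norm ?ltW // ltr_pM2l.
rewrite -ball_normE /= => yx; exists ((y + i%:R) / d%:R).
  rewrite /= -(ltr_pM2l d0) -{1}(ger0_norm (ltW d0)) -normrM.
  by rewrite mulrBr mulrCA divff ?mulr1 ?gt_eqF // opprD addrA addrAC.
by rewrite mulrCA divff ?mulr1 ?gt_eqF // addrK.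
Qed.

Lemma mass_support_bound : exists2 B : R, 0 <= B &
  (forall x r, B <= `|x| - r -> mass x r = 0) /\
  (forall x r, `|x| + B <= r -> mass x r = 1).
Proof.
have [K [cK muK]] := hcpt.
have [B [Br HB]] := compact_bounded cK.
pose B' := Num.max 0 B + 1.
have B'0 : 0 <= B' by rewrite addr_ge0 // le_max lexx.
have KB x : K x -> `|x| < B' + 1.
  move=> Kx; rewrite (@le_lt_trans _ _ B') ?ltrDl //; apply: HB Kx.
  by rewrite (@le_lt_trans _ _ (Num.max 0 B)) ?ltrDl // le_max lexx orbT.
have mK : measurable K by exact: compact_measurable.
exists (B' + 1); first by rewrite addr_ge0.
split=> x r H; apply: EFin_inj; rewrite -mass_fin.
  apply/eqP; rewrite eq_le measure_ge0 andbT.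
  suff : (mu (ball x r) <= mu (~` K))%E by rewrite muK.
  rewrite le_measure ?inE //.
  - exact: measurable_ball.
  - exact: measurableC.
  - move=> y; rewrite -ball_normE /= => yx Ky.
    have := KB _ Ky; have := ler_normD (x - y) y; rewrite subrK.
    by move: H yx; lra.
apply/eqP; rewrite eq_le probability_le1 /=; last exact: measurable_ball.
have <- : mu K = 1%E.
  have := probability_setC mu (measurableC mK).
  by rewrite setCK muK sube0.
rewrite le_measure ?inE //; first exact: measurable_ball.
move=> y Ky; rewrite -ball_normE /=; have := KB _ Ky.
have := ler_normB x y; move: H; lra.
Qed.

Lemma pow_unbounded (B e : R) : 0 < e -> exists n, B <= d%:R ^+ n * e.
Proof.
move=> e0; have [n Hn] : exists n : nat, B / e <= n%:R.
  exists (Num.bound (B / e)).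
  exact: ltW (le_lt_trans (ler_norm _) (unstable.ltr_norm_bound _)).
exists n; rewrite -ler_pdivrMr //; apply: le_trans Hn _.
rewrite -natrX ler_nat ltnW // ltn_expl // (leq_trans _ hd) //.
Qed.

(** Every map [x -> d x - i] multiplies the gap between the ball and [[0, xi]] by at least [d]; on
    the right this uses [d xi = xi + m]. After finitely many steps all balls involved are beyond the
    bound [B] and have mass zero. *)
Lemma mass_outside x r : x + r < 0 \/ xi R d m < x - r -> mass x r = 0.
Proof.
have d0 : 1 <= d%:R - 1 :> R by have := hd; rewrite -(ler_nat R); lra.
have [B B0 [HB _]] := mass_support_bound.
have xE : d%:R * xi R d m = xi R d m + m%:R.
  by rewrite /xi; field; rewrite gt_eqF // (lt_le_trans _ d0).
have xi0 : 0 <= xi R d m by rewrite /xi divr_ge0 //; lra.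
have sum0 y s : (forall i, (i <= m)%N -> mass (d%:R * y - i%:R) (d%:R * s) = 0) ->
    mass y s = 0.
  move=> H; rewrite mass_self_similar big1 // => i _.
  by rewrite H ?mulr0 // -ltnS.
case=> H.
  have [n] := @pow_unbounded B (- (x + r)) ltac:(lra).
  elim: n x r H => [|n IH] x r H; rewrite ?expr0 ?mul1r => Hn.
    by apply: HB; have := ler_norm (- x); rewrite normrN; lra.
  apply: sum0 => i im; apply: IH.
    rewrite addrAC -mulrDr; have := ler0n R i; nra.
  apply: le_trans Hn _; rewrite exprSr -mulrA ler_pM2l ?exprn_gt0 //; last lra.
  by have := ler0n R i; lra.
have [n] := @pow_unbounded B (x - r - xi R d m) ltac:(lra).
elim: n x r H => [|n IH] x r H; rewrite ?expr0 ?mul1r => Hn.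
  by apply: HB; have := ler_norm x; lra.
apply: sum0 => i im; have im' : i%:R <= m%:R :> R by rewrite ler_nat.
apply: IH.
  by have := ler0n R i; nra.
apply: le_trans Hn _; rewrite exprSr -mulrA ler_pM2l ?exprn_gt0 //; last lra.
by nra.
Qed.

(* [X n] are the values of the tails of an expansion of [X 0]. *)
Lemma mass_lower_bound (r : R) : 0 < r -> exists2 k : R, 0 < k &
  forall (w : nat -> nat) (X : nat -> R), (forall n, (w n <= m)%N) ->
    (forall n, 0 <= X n <= xi R d m) ->
    (forall n, d%:R * X n = (w n)%:R + X n.+1) ->
    forall n, k <= mass (X n) r.
Proof.
move=> r0.
have [B B0 [_ HB]] := mass_support_bound.
have [c c0 Hc] : exists2 c : R, 0 < c & forall i, (i <= m)%N -> c <= p i.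
  elim: m hpos => [|k IH] H; first by exists (p 0); [exact: H | move=> [|i]].
  have [c c0 Hc] := IH (fun i ik => H i (leqW ik)).
  exists (Num.min c (p k.+1)); first by rewrite lt_min c0 H.
  move=> i; rewrite leq_eqVlt => /predU1P[->|]; first by rewrite ge_min lexx orbT.
  by rewrite ltnS => /Hc ci; rewrite ge_min ci.
(* After [N] steps the radius is at least [xi + B], so the ball has full mass. Keeping at each step
   only the summand of the digit [w n] costs a factor of at least [c]. *)
have [N HN] := @pow_unbounded (xi R d m + B) r r0.
exists (c ^+ N); first exact: exprn_gt0.
move=> w X wm X01 Xrec.
elim: N r {r0} HN => [|N IH] r HN n.
  rewrite expr0 HB //; move: HN; rewrite expr0 mul1r; apply: le_trans.
  by have /andP[X0 X1] := X01 n; rewrite ger0_norm // lerD2r.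
rewrite mass_self_similar (bigD1 (inord (w n))) //= inordK ?ltnS //.
rewrite exprS -[leLHS]addr0; apply: lerD.
  apply: ler_pM; rewrite ?exprn_ge0 ?(ltW c0) ?Hc //.
  by rewrite Xrec addrC addKr; apply: IH; rewrite mulrA -exprSr.
apply: sumr_ge0 => i _; rewrite mulr_ge0 ?mass_ge0 // ltW // hpos // -ltnS //.
Qed.

End BallMass.

(** * Local dimension from scaling along a sequence of scales *)

Section LocalDimension.
Variables (R : realType) (d : nat) (mu : probability R R).
Hypothesis hd : (3 <= d)%N.

Lemma supp_mass x : (forall r, 0 < r -> 0 < mass mu x r) -> supp mu x.
Proof. by move=> H r r0; rewrite mass_fin lte_fin H. Qed.

Lemma locdim_of_log_bound (x alpha r1 K : R) :
    0 < r1 ->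
    (forall r, 0 < r < r1 -> `|ln (mass mu x r) - alpha * ln r| <= K) ->
  locdim_is mu x alpha.
Proof.
move=> r10 H; apply/cvgrPdist_lt => e e0.
have K0 : 0 <= K.
  apply: le_trans (H (r1 / 2) _); first exact: normr_ge0.
  by apply/andP; split; lra.
(* Below this radius [e * |ln r|] exceeds [K], so the bounded error divided by [ln r] is less than
   [e]. *)
have s0 : 0 < expR (- (K / e + 1)) by exact: expR_gt0.
near=> r.
have r0 : 0 < r by near: r; exact: nbhs_right_gt.
have rr1 : r < r1 by near: r; exact: nbhs_right_lt.
have rs : r < expR (- (K / e + 1)) by near: r; exact: nbhs_right_lt.
have Ke : 0 <= K / e by rewrite divr_ge0 // ltW.
have lnr : ln r < - (K / e + 1) by rewrite -ltr_expR lnK ?posrE.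
have lnr0 : ln r < 0 by lra.
have := H r; rewrite r0 rr1 => /(_ isT) HK.
have -> : alpha - ln (fine (mu (ball x r))) / ln r
        = - (ln (mass mu x r) - alpha * ln r) / ln r.
  by rewrite /mass; field; rewrite lt_eqF.
rewrite normrM normfV normrN (ltr0_norm lnr0) ltr_pdivrMr ?oppr_gt0 //.
apply: le_lt_trans HK _.
have : e * (K / e + 1) < e * - ln r by rewrite ltr_pM2l //; lra.
by rewrite mulrDr mulrCA divff ?gt_eqF // mulr1; lra.
Unshelve. all: by end_near. Qed.

(** Since the scales [n j] have gaps at most [L], every small [r] is rescaled by some [d^(n j)] into
    the window from [r0 / d^L] to [r0]. There the mass around [Y j] lies between a positive constant
    and [1], so [ln (mass mu x r) - alpha ln r] stays bounded. *)
Lemma locdim_of_scaling (x alpha r0 q1 q2 : R) (L : nat) (Y Q : nat -> R)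
    (n : nat -> nat) :
    0 < r0 -> 0 < q1 -> (forall j, q1 <= Q j <= q2) ->
    n 0 = 0 -> (forall j, (n j < n j.+1 <= n j + L)%N) ->
    (forall r, 0 < r -> exists2 k, 0 < k & forall j, k <= mass mu (Y j) r) ->
    (forall j r, 0 < r -> d%:R ^+ n j * r < r0 ->
       mass mu x r = mass mu (Y j) (d%:R ^+ n j * r)
                     * (expR (- alpha * ln d%:R * (n j)%:R) * Q j)) ->
  locdim_is mu x alpha.
Proof.
move=> r00 q10 HQ n0 nS HY Hx.
have d1 : 1 < d%:R :> R by rewrite ltr1n (leq_trans _ hd).
have d0 : 0 < d%:R :> R by lra.
have lnd : 0 < ln d%:R :> R by rewrite ln_gt0.
have dX k : 0 < d%:R ^+ k :> R by rewrite exprn_gt0.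
have [k k0 Hk] := HY (r0 / d%:R ^+ L) (divr_gt0 r00 (dX L)).
have nj j : (j <= n j)%N.
  elim: j => [|j IH]; first by rewrite n0.
  by apply: leq_ltn_trans IH _; have /andP[] := nS j.
apply: (@locdim_of_log_bound _ _ r0
  (`|ln k| + (`|ln q1| + `|ln q2|) + `|alpha| * (`|ln r0| + L%:R * ln d%:R))) => //.
move=> r /andP[rp rr0].
have ex : exists j, r0 <= d%:R ^+ n j * r.
  have [N HN] := @pow_unbounded R d hd r0 r rp; exists N.
  by apply: le_trans HN _; rewrite ler_pM2r // ler_weXn2l // ltW.
(* The first scale that reaches [r0] is not the scale [0], as [r < r0]; its predecessor [j] is the
   scale to use. *)
case: (ex_minnP ex) => -[|j] Hj jmin.
  by move: Hj; rewrite n0 expr0 mul1r leNgt rr0.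
have small : d%:R ^+ n j * r < r0.
  by rewrite ltNge; apply/negP => /jmin; rewrite ltnn.
have [nS1 nS2] := andP (nS j).
set s := d%:R ^+ n j * r in small.
have s0 : 0 < s by rewrite mulr_gt0.
have sL : r0 / d%:R ^+ L <= s.
  rewrite ler_pdivrMr // (le_trans Hj) // /s mulrAC ler_pM2r // -exprD.
  by rewrite ler_weXn2l // ltW.
have mk : k <= mass mu (Y j) s.
  apply: le_trans (Hk j) _; apply: mass_mono.
  by rewrite subrr normr0 add0r.
have m0 : 0 < mass mu (Y j) s by exact: lt_le_trans mk.
have Qj := HQ j; have /andP[Q1 Q2] := Qj.
have Q0 : 0 < Q j by exact: lt_le_trans Q1.
rewrite (Hx j r rp small) -/s lnM ?posrE //; last by rewrite mulr_gt0 ?expR_gt0.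
rewrite lnM ?posrE ?expR_gt0 // expRK.
have lns : ln s = (n j)%:R * ln d%:R + ln r.
  by rewrite /s lnM ?posrE // lnXn // mulr_natl.
have ln1 : ln k <= ln (mass mu (Y j) s) by rewrite ler_ln ?posrE.
have ln2 : ln (mass mu (Y j) s) <= 0 by rewrite ln_le0 // mass_le1.
have ln3 : ln q1 <= ln (Q j) by rewrite ler_ln ?posrE.
have ln4 : ln (Q j) <= ln q2 by rewrite ler_ln ?posrE // (lt_le_trans Q0).
have ln5 : ln s <= ln r0 by rewrite ler_ln ?posrE // ltW.
have ln6 : ln r0 - L%:R * ln d%:R <= ln s.
  have <- : ln (r0 / d%:R ^+ L) = ln r0 - L%:R * ln d%:R.
    by rewrite lnM ?posrE ?invr_gt0 // lnV ?posrE // lnXn // mulr_natl.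
  by rewrite ler_ln ?posrE // divr_gt0.
have -> : ln (mass mu (Y j) s) + (- alpha * ln d%:R * (n j)%:R + ln (Q j))
          - alpha * ln r = ln (mass mu (Y j) s) + ln (Q j) - alpha * ln s.
  by rewrite lns; ring.
apply: le_trans (ler_normB _ _) _; apply: lerD.
  apply: le_trans (ler_normD _ _) _; apply: lerD.
    by rewrite (ler0_norm ln2); have := ler_norm (- ln k); rewrite normrN; lra.
  rewrite ler_norml; have := ler_norm (- ln q1); have := ler_norm (ln q2).
  rewrite normrN; have := normr_ge0 (ln q1); have := normr_ge0 (ln q2).
  by move=> *; apply/andP; split; lra.
rewrite normrM ler_wpM2l // ler_norml.
have := ler_norm (ln r0); have := ler_norm (- ln r0); rewrite normrN => h1 h2.
have : 0 <= L%:R * ln d%:R :> R by rewrite mulr_ge0 // ltW.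
by move=> *; apply/andP; split; lra.
Qed.

End LocalDimension.

(** * Digit expansions and the barrier *)

Section DigitExpansion.
Variables (R : realType) (d m : nat).
Hypothesis hd : (3 <= d)%N.

Let d1 : 1 < d%:R :> R.
Proof. by rewrite ltr1n ltnW. Qed.

Lemma xi_fixpoint : d%:R * xi R d m = m%:R + xi R d m.
Proof. by rewrite /xi; field; rewrite gt_eqF //; have := d1; lra. Qed.

Lemma xi_ge0 : 0 <= xi R d m.
Proof. by rewrite /xi divr_ge0 //; have := d1; lra. Qed.

(** Induction on [N], splitting off the first digit: the bound is preserved because
    [(m + xi) / d = xi]. *)
Lemma pi_inf_partial_le (w : nat -> nat) N : (forall i, (w i <= m)%N) ->
  series (fun i : nat => (w i)%:R / (d%:R : R) ^+ i.+1) N <= xi R d m.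
Proof.
move=> wm; elim: N w wm => [|N IH] w wm; first by rewrite /series /= big_geq // xi_ge0.
rewrite /series /= big_nat_recl //= expr1.
have -> : \sum_(0 <= i < N) ((w i.+1)%:R / (d%:R : R) ^+ i.+2)
        = d%:R^-1 * series (fun i : nat => (w i.+1)%:R / (d%:R : R) ^+ i.+1) N.
  rewrite /series /= mulr_sumr; apply: eq_bigr => i _.
  by rewrite exprS invfM mulrCA.
have := IH (fun i => w i.+1) (fun i => wm i.+1) => IHw.
rewrite mulrC -mulrDr mulrC ler_pdivrMr; last by have := d1; lra.
rewrite mulrC xi_fixpoint lerD // ler_nat //.
Qed.

Lemma pi_inf_cvg (w : nat -> nat) : (forall i, (w i <= m)%N) ->
  series (fun i : nat => (w i)%:R / (d%:R : R) ^+ i.+1) @ \oo --> pi_inf R d w.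
Proof.
move=> wm; apply: nondecreasing_is_cvgn.
  apply/nondecreasing_seqP => N; rewrite /series /= big_nat_recr //= lerDl.
  by rewrite divr_ge0 // exprn_ge0 //; have := d1; lra.
by exists (xi R d m) => _ [N _ <-]; exact: pi_inf_partial_le.
Qed.

Lemma pi_inf_le_xi (w : nat -> nat) : (forall i, (w i <= m)%N) ->
  0 <= pi_inf R d w <= xi R d m.
Proof.
move=> wm; have wc := @pi_inf_cvg w wm; apply/andP; split.
  apply: limr_ge; first exact: cvgP wc.
  apply: nearW => N; apply: sumr_ge0 => i _.
  by rewrite divr_ge0 // exprn_ge0 //; have := d1; lra.
apply: limr_le; first exact: cvgP wc.
by apply: nearW => N; exact: pi_inf_partial_le.
Qed.

Lemma pi_inf_rec (w : nat -> nat) : (forall i, (w i <= m)%N) ->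
  d%:R * pi_inf R d w = (w 0)%:R + pi_inf R d (fun i => w i.+1).
Proof.
move=> wm; have wc := @pi_inf_cvg w wm.
have wc' := @pi_inf_cvg (fun i => w i.+1) (fun i => wm i.+1).
move: wc; rewrite -(cvg_shiftS (series _)).
set u := (X in X @ _ --> _ -> _).
have -> : u = (fun N => ((w 0)%:R + series (fun i : nat =>
    (w i.+1)%:R / (d%:R : R) ^+ i.+1) N) / d%:R).
  apply/funext => N; rewrite /u /series /= big_nat_recl //= expr1.
  rewrite mulrDl; congr (_ + _); rewrite mulr_suml; apply: eq_bigr => i _.
  by rewrite [in LHS]exprS invfM mulrAC mulrA.
move=> H1.
have H2 : ((w 0)%:R + series (fun i : nat => (w i.+1)%:R / (d%:R : R) ^+ i.+1) N)
    / d%:R @[N --> \oo] --> ((w 0)%:R + pi_inf R d (fun i => w i.+1)) / d%:R.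
  by apply: cvgMr_tmp; apply: cvgD => //; exact: cvg_cst.
have -> : pi_inf R d w = ((w 0)%:R + pi_inf R d (fun i => w i.+1)) / d%:R.
  exact: (cvg_unique _ H1 H2).
by field; rewrite gt_eqF //; have := d1; lra.
Qed.

End DigitExpansion.

Section Barrier.
Variables (R : realType) (d m b : nat).
Hypothesis hd : (3 <= d)%N.
Hypothesis hm : (d <= m)%N.

(** The barrier condition is tested on the extreme sequences [b m m m ...] and [b 0 0 0 ...], which
    give [b + xi < d] and [m + xi < b + d]. As [xi > 1], both integer gaps are at least [2]. *)
Lemma barrier_digit_bounds : barrier_digit R d m b -> (b.+2 <= d /\ m.+2 <= b + d)%N.
Proof.
case=> bm Hb.
have d1 : 1 < d%:R :> R by rewrite ltr1n ltnW.
have dm : d%:R <= m%:R :> R by rewrite ler_nat.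
have pi_cst (c : nat) : (c <= m)%N ->
    d%:R * pi_inf R d (fun=> c) = c%:R + pi_inf R d (fun=> c).
  by move=> cm; rewrite {1}(@pi_inf_rec R d m hd (fun=> c)).
have wm (c : nat) : (c <= m)%N -> forall i, ((if i is 0 then b else c) <= m)%N.
  by move=> cm [|i].
have [] := Hb _ (wm 0 isT) erefl; have [] := Hb _ (wm m (leqnn m)) erefl.
have := @pi_inf_rec R d m hd _ (wm 0 isT).
have := @pi_inf_rec R d m hd _ (wm m (leqnn m)).
have := pi_cst 0 isT; have := pi_cst m (leqnn m).
have := xi_fixpoint R m hd; rewrite /=.
move: (pi_inf R d (fun=> m)) (pi_inf R d (fun=> 0)) => y0 y1.
move=> h1 h2 h3 h4 h5 h6 [_ h7] h8 [_ h9].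
have xi1 : 1 < xi R d m by rewrite /xi ltr_pdivlMr; lra.
have d10 : d%:R - 1 != 0 :> R by rewrite gt_eqF; lra.
have e0 : y0 = xi R d m by apply: (mulfI d10); rewrite !mulrBl; lra.
have e1 : y1 = 0 by apply: (mulfI d10); rewrite !mulrBl; lra.
by split; rewrite -(ltr_nat R) ?natrD -?natr1; nra.
Qed.

Hypothesis hb1 : (b.+2 <= d)%N.
Hypothesis hb2 : (m.+2 <= b + d)%N.

(** The two bounds on [b] add up to [m + 4 <= 2 d], so [m - d < d - 1]. *)
Lemma adim_barrier : adim d m = 1.
Proof. by rewrite /adim divn_small // ltn_subLR //; lia. Qed.

Lemma xi_lt2 : xi R d m < 2.
Proof.
have d1 : 1 < d%:R :> R by rewrite ltr1n ltnW.
have : m%:R + 2 < 2 * d%:R :> R by rewrite -natrD -natrM ltr_nat; lia.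
by rewrite /xi ltr_pdivrMr; lra.
Qed.

End Barrier.

(** * Transfer matrices *)

Section Transfer.
Variables (R : realType) (d m : nat) (p : nat -> R).

(* Convertible to [Mi d m p i] for [a := adim d m]; a separate parameter [a]
   allows rewriting with [adim d m = 1], which a barrier digit forces. *)
Definition transfer (a i : nat) : 'M[R]_(a.*2.+1) :=
  \matrix_(k, l) pz m p ((k%:Z - a%:Z) + i%:Z - (l%:Z - a%:Z) * d%:Z).

Definition transfer_word (a : nat) (s : seq nat) : 'M[R]_(a.*2.+1) :=
  \prod_(i <- rev s) transfer a i.

Lemma transfer_word_cat a s1 s2 :
  transfer_word a (s1 ++ s2) = transfer_word a s2 * transfer_word a s1.
Proof. by rewrite /transfer_word rev_cat big_cat. Qed.

Lemma transfer_word1 a i : transfer_word a [:: i] = transfer a i.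
Proof. by rewrite /transfer_word big_cons big_nil mulr1. Qed.

Lemma transfer_word_cons a i s :
  transfer_word a (i :: s) = transfer_word a s * transfer a i.
Proof. by rewrite -cat1s transfer_word_cat transfer_word1. Qed.

Lemma transfer_word_flatten_nseq a s N :
  transfer_word a (flatten (nseq N s)) = transfer_word a s ^+ N.
Proof.
elim: N => [|N IH]; first by rewrite /transfer_word big_nil expr0.
by rewrite /= transfer_word_cat IH exprSr.
Qed.

Hypothesis hpos : forall i, (i <= m)%N -> 0 < p i.
Hypothesis hsum : \sum_(i < m.+1) p i = 1.

Lemma pz_nat i : (i <= m)%N -> pz m p i%:Z = p i.
Proof. by move=> im; rewrite /pz lez_nat im. Qed.

Lemma pz_ge0 z : 0 <= pz m p z.
Proof.
rewrite /pz; case: ifP => // /andP[z0 zm]; apply: ltW; apply: hpos.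
by move: z0 zm; case: z.
Qed.

(** Writing an entry as a sum over digits allows the sums over digits and over matrix indices to be
    exchanged. *)
Lemma pz_sum z : pz m p z = \sum_(i < m.+1) p i * (i%:Z == z)%:R.
Proof.
rewrite /pz; case: ifP => [/andP[]|].
  case: z => // z _; rewrite lez_nat -ltnS => zm.
  rewrite (bigD1 (Ordinal zm)) //= eqxx mulr1 big1 ?addr0 // => i.
  by rewrite -val_eqE /= eqz_nat => /negbTE ->; rewrite mulr0.
move=> H; rewrite big1 // => i _; case: eqP => [iz|]; last by rewrite mulr0.
by move: H; rewrite -iz lez_nat -ltnS ltn_ord.
Qed.

Lemma transfer_ge0 a i k l : 0 <= transfer a i k l.
Proof. by rewrite mxE pz_ge0. Qed.

Lemma transfer_word_ge0 a s k l : 0 <= transfer_word a s k l.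
Proof.
elim: s k l => [|i s IH] k l; first by rewrite /transfer_word big_nil mxE.
rewrite transfer_word_cons mxE; apply: sumr_ge0 => j _.
by rewrite mulr_ge0 // transfer_ge0.
Qed.

(** Within one column, distinct rows correspond to distinct digits, so each [p j] is counted at most
    once. *)
Lemma transfer_col_sum_le1 a i l : \sum_k transfer a i k l <= 1.
Proof.
rewrite -hsum.
have -> : \sum_k transfer a i k l = \sum_(j < m.+1) p j *
   \sum_(k < a.*2.+1) (j%:Z == (k%:Z - a%:Z) + i%:Z - (l%:Z - a%:Z) * d%:Z)%:R.
  under eq_bigr do rewrite mxE pz_sum.
  by rewrite exchange_big /=; apply: eq_bigr => j _; rewrite mulr_sumr.
apply: ler_sum => j _; rewrite -[leRHS]mulr1 ler_wpM2l //.
  by rewrite ltW // hpos // -ltnS.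
rewrite -natr_sum lern1 -big_mkcond sum1_card.
apply/card_le1_eqP => k k' kj kj'.
have H := etrans (esym (eqP (kj : j%:Z == _))) (eqP (kj' : j%:Z == _)).
by have [kk] := addIr _ (addIr _ (addIr _ H)); apply: val_inj.
Qed.

Lemma transfer_word_col_sum_le1 a s l : \sum_k transfer_word a s k l <= 1.
Proof.
elim: s l => [|i s IH] l.
  rewrite /transfer_word big_nil (bigD1 l) //= mxE eqxx big1 ?addr0 // => k /negbTE kl.
  by rewrite mxE kl.
under eq_bigr do rewrite transfer_word_cons mxE.
rewrite exchange_big /=.
apply: le_trans (transfer_col_sum_le1 i l); apply: ler_sum => j _.
by rewrite -mulr_suml -[leRHS]mul1r ler_wpM2r // transfer_ge0.
Qed.

Lemma transfer_word_sum_le a s :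
  \sum_k \sum_l `|transfer_word a s k l| <= (a.*2.+1)%:R.
Proof.
rewrite exchange_big /= -[leRHS]mulr1 -[in leRHS](card_ord a.*2.+1).
rewrite mulr_natl -sumr_const; apply: ler_sum => l _.
under eq_bigr do rewrite ger0_norm ?transfer_word_ge0 //.
exact: transfer_word_col_sum_le1.
Qed.

End Transfer.

(** * Blocks starting with the barrier digit *)

Section GeometricDecay.
Variable R : realType.

Lemma exp_lt_eps (q e : R) : 0 <= q < 1 -> 0 < e -> exists N, q ^+ N < e.
Proof.
move=> /andP[q0 q1] e0.
have /cvgrPdist_lt/(_ _ e0)[N _ /(_ N (leqnn N))] :
  GRing.exp q @ \oo --> (0 : R) by apply: cvg_expr; rewrite ger0_norm.
by rewrite /= sub0r normrN ger0_norm ?exprn_ge0 //; exists N.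
Qed.

Lemma powR_root (x : R) k : 0 <= x -> (0 < k)%N -> (x ^+ k) `^ (k%:R^-1) = x.
Proof.
move=> x0 k0.
by rewrite -powR_mulrn // -powRrM mulfV ?powRr1 // pnatr_eq0 -lt0n.
Qed.

Lemma powR_root_lt (t x : R) k : 0 < t -> (0 < k)%N ->
  x `^ (k%:R^-1) < t -> x < t ^+ k.
Proof.
move=> t0 k0; rewrite !ltNge; apply: contra => tx.
rewrite -[leLHS](powR_root (ltW t0) k0).
have tk0 : 0 <= t ^+ k by rewrite exprn_ge0 // ltW.
by apply: ge0_ler_powR; rewrite ?nnegrE ?invr_ge0 // (le_trans tk0).
Qed.

Lemma lt_powR_root (t x : R) k : 0 < t -> 0 <= x -> (0 < k)%N ->
  t < x `^ (k%:R^-1) -> t ^+ k < x.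
Proof.
move=> t0 x0 k0; rewrite !ltNge; apply: contra => xt.
rewrite -[leRHS](powR_root (ltW t0) k0).
by apply: ge0_ler_powR; rewrite ?nnegrE ?invr_ge0 ?exprn_ge0 ?(ltW t0).
Qed.

End GeometricDecay.

Section Blocks.
Variables (R : realType) (d m b : nat) (p : nat -> R).
Hypothesis hd : (3 <= d)%N.
Hypothesis hm : (d <= m)%N.
Hypothesis hpos : forall i, (i <= m)%N -> 0 < p i.
Hypothesis hsum : \sum_(i < m.+1) p i = 1.
Hypothesis hb1 : (b.+2 <= d)%N.
Hypothesis hb2 : (m.+2 <= b + d)%N.

Local Notation T := (transfer d m p 1).
Local Notation Tw := (transfer_word d m p 1).
Local Notation digits := (all (fun i => i <= m)%N).

(* The index standing for the integer [0] in [{-1, 0, 1}]. *)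
Definition mid : 'I_(1.*2.+1) := @Ordinal (1.*2.+1) 1 isT.

Let bm : (b <= m)%N. Proof. exact: leq_trans (ltnW (ltnW hb1)) hm. Qed.

Let T_ge0 := transfer_ge0 d hpos.
Let Tw_ge0 := transfer_word_ge0 d hpos.

(** For [e] in [{-1, 0, 1}] one has [e + b - d < 0] and [e + b + d > m], so the outer columns only
    meet the zero extension of [p]. *)
Lemma transfer_barrier_col k l : l != mid -> T b k l = 0.
Proof.
move=> lmid; rewrite mxE /pz; case: ifP => // /andP[].
case: l lmid => [[|[|[|l]]] Hl] //= _; case: k => k /= Hk; have := hb1; have := hb2; lia.
Qed.

Lemma transfer_barrier_mid_gt0 k : 0 < T b k mid.
Proof.
rewrite mxE; case: k => k /= Hk.
have -> : (k%:Z - 1%:Z + b%:Z - (1%:Z - 1%:Z) * d%:Z) = (k + b).-1%:Z.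
  by have := hb2; have := hb1; have := hm; lia.
have le_m : ((k + b).-1 <= m)%N by have := hb1; have := hm; lia.
by rewrite pz_nat // hpos.
Qed.

Lemma transfer_mid i : (i <= m)%N -> T i mid mid = p i.
Proof.
move=> im; rewrite mxE /= subrr mul0r subr0 add0r.
by rewrite pz_nat.
Qed.

Lemma transfer_word_mid_gt0 s : digits s -> 0 < Tw s mid mid.
Proof.
elim: s => [|i s IH] /=; first by rewrite /transfer_word big_nil mxE eqxx.
move=> /andP[im sm]; rewrite transfer_word_cons mxE (bigD1 mid) //=.
rewrite ltr_pwDl //; first by rewrite mulr_gt0 ?IH // transfer_mid // hpos.
by apply: sumr_ge0 => j _; rewrite mulr_ge0 ?Tw_ge0 ?T_ge0.
Qed.

(* [M_b] has only its middle column, so entry [(0, 0)] is multiplicative over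
   blocks starting with [b]. *)
Lemma transfer_word_cat_barrier s1 s2 :
  Tw (s1 ++ b :: s2) mid mid = Tw (b :: s2) mid mid * Tw s1 mid mid.
Proof.
rewrite transfer_word_cat mxE (bigD1 mid) //= big1 ?addr0 // => k kmid.
rewrite transfer_word_cons mxE big1 ?mul0r // => j _.
by rewrite transfer_barrier_col ?mulr0.
Qed.

Lemma transfer_barrier_le1 k : T b k mid <= 1.
Proof.
apply: le_trans (transfer_col_sum_le1 d hpos hsum b mid).
by rewrite (bigD1 k) //= lerDl; apply: sumr_ge0 => j _; exact: T_ge0.
Qed.

Lemma digits_flatten_nseq N s : digits s -> digits (flatten (nseq N s)).
Proof. by move=> sm; elim: N => [|N IH] //=; rewrite all_cat sm. Qed.

Lemma size_flatten_nseq (A : Type) N (s : seq A) :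
  size (flatten (nseq N s)) = (size s * N)%N.
Proof. by elim: N => [|N IH]; rewrite /= ?muln0 // size_cat IH mulnS. Qed.

(** The block is [b u^N]. Its middle entry is at most [3 C' s^N] for some [s < tau], so a large [N]
    absorbs the constant and the factor [t] due to the letter [b]. *)
Lemma exists_light_block (t : R) u : 0 < t -> digits u ->
    specrad (Tw u) < t ^+ size u ->
  exists2 s, digits s & Tw (b :: s) mid mid < t ^+ (size s).+1.
Proof.
move=> t0 um ut; set tau := t ^+ size u in ut.
have tau0 : 0 < tau by exact: exprn_gt0.
pose s := (Num.max 0 (specrad (Tw u)) + tau) / 2.
have M0 : 0 <= Num.max 0 (specrad (Tw u)) by rewrite le_max lexx.
have Mt : Num.max 0 (specrad (Tw u)) < tau by rewrite gt_max tau0.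
have Mu : specrad (Tw u) <= Num.max 0 (specrad (Tw u)) by rewrite le_max lexx orbT.
have s0 : 0 < s by rewrite /s; lra.
have st : s < tau by rewrite /s; lra.
have us : specrad (Tw u) < s by rewrite /s; lra.
have [C HC] := specrad_pow_bound s0 us.
pose C' := Num.max C 1.
have C'0 : 0 < C' by rewrite lt_max ltr01 orbT.
have HC' N i j : (Tw u ^+ N) i j <= C' * s ^+ N.
  apply: le_trans (ler_norm _) _; apply: le_trans (HC N i j) _.
  by rewrite ler_wpM2r ?exprn_ge0 ?(ltW s0) // le_max lexx.
have [N HN] : exists N, (s / tau) ^+ N < t / (C' * 3).
  apply: exp_lt_eps; last by rewrite divr_gt0 // mulr_gt0.
  by rewrite divr_ge0 ?ltW //= ltr_pdivrMr // mul1r.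
exists (flatten (nseq N u)); first exact: digits_flatten_nseq.
rewrite transfer_word_cons transfer_word_flatten_nseq mxE.
apply: (@le_lt_trans _ _ (\sum_(j < 1.*2.+1) C' * s ^+ N)).
  apply: ler_sum => j _; rewrite -[leRHS]mulr1 ler_pM ?T_ge0 //.
    by rewrite -transfer_word_flatten_nseq Tw_ge0.
  exact: transfer_barrier_le1.
rewrite sumr_const card_ord -mulrnAl.
rewrite exprS size_flatten_nseq exprM -/tau.
have tauN : 0 < tau ^+ N by exact: exprn_gt0.
have -> : C' *+ 1.*2.+1 * s ^+ N = s ^+ N / tau ^+ N * (C' * 3) * tau ^+ N.
  by rewrite -[C' *+ _]/(C' *+ 3) -mulr_natr; field; rewrite gt_eqF.
by rewrite ltr_pM2r // -ltr_pdivlMr ?mulr_gt0 // -expr_div_n.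
Qed.

Lemma exists_heavy_block (t : R) u : 0 < t -> digits u ->
    t ^+ size u < specrad (Tw u) ->
  exists2 s, digits s & t ^+ (size s).+1 < Tw (b :: s) mid mid.
Proof.
move=> t0 um ut; set tau := t ^+ size u in ut.
have tau0 : 0 < tau by exact: exprn_gt0.
pose s := (specrad (Tw u) + tau) / 2.
have st : tau < s by rewrite /s; lra.
have su : s < specrad (Tw u) by rewrite /s; lra.
have s0 : 0 < s by lra.
pose y (k : 'I_(1.*2.+1)) : nat := if val k == 2 then d else 0.
have ym k : (y k <= m)%N by rewrite /y; case: ifP.
(* from offset [0] the letter [y k] leads to the offset with index [k] *)
have Ty k : 0 < T (y k) mid k.
  rewrite mxE /y; case: k => -[|[|[|k]]] Hk //=.
  - have -> : (1%:Z - 1%:Z + 0%:Z - (0%:Z - 1%:Z) * d%:Z) = d%:Z by lia.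
    by rewrite pz_nat // hpos.
  - have -> : (1%:Z - 1%:Z + 0%:Z - (1%:Z - 1%:Z) * d%:Z) = 0%:Z by lia.
    by rewrite pz_nat // hpos.
  - have -> : (1%:Z - 1%:Z + d%:Z - (2%:Z - 1%:Z) * d%:Z) = 0%:Z by lia.
    by rewrite pz_nat // hpos.
(* [kap] bounds from below the joint cost of entering any column [l] through [b] and leaving any row
   [k] through [y k], so an arbitrary entry of [A] contributes to the middle entry. *)
have [kap kap0 Hkap] : exists2 kap : R, 0 < kap &
    forall k l, kap <= T (y k) mid k * T b l mid.
  exists (\big[Num.min/1]_(kl : 'I_(1.*2.+1) * 'I_(1.*2.+1))
           (T (y kl.1) mid kl.1 * T b kl.2 mid)).
    elim/big_ind: _ => // [x z x0 z0|[k l] _]; first by rewrite lt_min x0.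
    by rewrite mulr_gt0 ?Ty ?transfer_barrier_mid_gt0.
  by move=> k l; exact: (bigmin_le _ (k, l)).
(* The factor [t ^+ 2] pays for the two extra letters [b] and [y k], and [3] for the choice among
   three rows. *)
have [N HN] : exists N, (tau / s) ^+ N < kap / (t ^+ 2 * 3).
  apply: exp_lt_eps; last by rewrite divr_gt0 // mulr_gt0 // exprn_gt0.
  by rewrite divr_ge0 ?ltW //= ltr_pdivrMr // mul1r.
set A := Tw u ^+ N.
have A0 k l : 0 <= A k l by rewrite /A -transfer_word_flatten_nseq Tw_ge0.
pose W k := rcons (flatten (nseq N u)) (y k).
have TwW k : kap * \sum_l A k l <= Tw (b :: W k) mid mid.
  rewrite transfer_word_cons /W -cats1 transfer_word_cat transfer_word1.
  rewrite transfer_word_flatten_nseq -/A mulr_sumr mxE; apply: ler_sum => l _.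
  rewrite mxE (bigD1 k) //= mulrDl mulrAC.
  rewrite -[leLHS]addr0 lerD ?ler_wpM2r //.
  by rewrite mulr_ge0 ?sumr_ge0 ?T_ge0 // => j _; rewrite mulr_ge0 ?T_ge0 ?A0.
(* Pigeonhole over the rows: the entries of [A] sum to at least [s ^+ N], so the three blocks cannot
   all be too light. *)
have [k Hk] : exists k, tau ^+ N * t ^+ 2 < Tw (b :: W k) mid mid.
  apply/not_existsP => H.
  have : kap * s ^+ N <= 3 * (tau ^+ N * t ^+ 2).
    apply: (@le_trans _ _ (\sum_k kap * \sum_l A k l)).
      rewrite -mulr_sumr ler_wpM2l ?(ltW kap0) //.
      apply: le_trans (lt_specrad_pow N (ltW s0) su) _.
      by apply: ler_sum => k _; apply: ler_sum => l _; rewrite ger0_norm ?A0.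
    have -> : 3 * (tau ^+ N * t ^+ 2) = \sum_(k < 1.*2.+1) tau ^+ N * t ^+ 2.
      by rewrite sumr_const card_ord mulr_natl.
    apply: ler_sum => k _; apply: le_trans (TwW k) _.
    by rewrite leNgt; apply/negP; exact: H.
  apply/negP; rewrite -ltNge; move: HN.
  have sN : 0 < s ^+ N by exact: exprn_gt0.
  rewrite expr_div_n ltr_pdivlMr ?mulr_gt0 ?exprn_gt0 // => HN.
  have -> : 3 * (tau ^+ N * t ^+ 2) = tau ^+ N / s ^+ N * (t ^+ 2 * 3) * s ^+ N.
    by field; rewrite gt_eqF.
  by rewrite ltr_pM2r.
exists (W k); first by rewrite /W all_rcons ym digits_flatten_nseq.
rewrite /W size_rcons size_flatten_nseq -/(W k).
by rewrite -addn2 exprD exprM -/tau.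
Qed.

(* [delta_mx 0 mid] is a left eigenvector of [M_b], with eigenvalue [p b]. *)
Lemma specrad_barrier_ge k : p b ^+ k <= specrad (Tw (nseq k b)).
Proof.
have eig : eigenvalue (map_mx (real_complex R) (Tw (nseq k b)))
             (real_complex R (p b ^+ k)).
  apply/eigenvalueP; exists (map_mx (real_complex R) (delta_mx 0 mid)).
    rewrite -map_mxM -map_mxZ; congr map_mx.
    elim: k => [|k IH]; first by rewrite /transfer_word big_nil mulmx1 scale1r.
    rewrite /= transfer_word_cons mulmxA IH -scalemxAl exprS mulrC -scalerA.
    congr (_ *: _); rewrite -rowE; apply/rowP => l; rewrite !mxE.
    have [->|lmid] := eqVneq l mid; last first.
      by have := transfer_barrier_col mid lmid; rewrite mxE mulr0.
    by have := transfer_mid bm; rewrite mxE mulr1.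
  apply/eqP => /rowP/(_ mid); rewrite !mxE !eqxx /= => /eqP.
  by rewrite fmorph_eq0 oner_eq0.
have := eigenvalue_le_specrad eig; apply: le_trans.
by rewrite normc_real ler_norm.
Qed.

(** The words [b^k] bound the sequence below by [p b], and the column sums bound it above by [3].
    The upper limit is therefore the infimum of the tail suprema, and any [t] below it is beaten by
    an actual word. *)
Lemma gen_specrad_barrier : 0 < gen_specrad d m p /\
  forall t, 0 < t -> t < gen_specrad d m p ->
    exists2 s, digits s & t ^+ size s < specrad (Tw s).
Proof.
have -> : gen_specrad d m p = limn_sup (fun k : nat =>
    (sup [set specrad (transfer_word d m p (adim d m) s) | s in words m k]) `^ (k%:R^-1)).
  by [].
rewrite (adim_barrier hd hm hb1 hb2); set u := (X in limn_sup X).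
pose S k := [set specrad (Tw s) | s in words m k].
have Sne k : S k (specrad (Tw (nseq k b))).
  by exists (nseq k b) => //; by rewrite /words /= size_nseq all_nseq bm orbT.
have S3 k : ubound (S k) 3.
  move=> _ [s _ <-]; apply: le_trans (specrad_le_sum _) _.
  exact: transfer_word_sum_le.
have pb0 : 0 < p b by exact: hpos.
have supS k : p b ^+ k <= sup (S k) <= 3.
  apply/andP; split.
    by apply: le_trans (specrad_barrier_ge k) _; apply: ub_le_sup => //; exists 3.
  by apply: ge_sup => //; exists (specrad (Tw (nseq k b))).
have supS0 k : 0 <= sup (S k).
  by have /andP[] := supS k => + _; apply: le_trans; rewrite exprn_ge0 // ltW.
have pbu k : p b <= u k.+1.
  rewrite -[leLHS](@powR_root _ _ k.+1) ?(ltW pb0) //.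
  have /andP[H _] := supS k.+1.
  apply: ge0_ler_powR; rewrite ?nnegrE ?invr_ge0 ?exprn_ge0 ?(ltW pb0) //.
  exact: supS0.
have u3 k : u k <= 3.
  have /andP[_ H] := supS k; apply: (@le_trans _ _ (3 `^ (k%:R^-1))).
    by apply: ge0_ler_powR; rewrite ?nnegrE ?invr_ge0 //; exact: supS0.
  rewrite -[leRHS]powRr1 //; apply: ler_powR; first by lra.
  by case: k {H} => [|k]; rewrite ?invr0 // invf_le1 // ler1n.
have ubu n : has_ubound (sdrop u n) by exists 3 => _ [k _ <-].
have ubr : has_ubound (range u) by exists 3 => _ [k _ <-].
have lbr : has_lbound (range u) by exists 0 => _ [k _ <-]; exact: powR_ge0.
have pbs n : p b <= sups u n.
  by apply: le_trans (pbu n) _; apply: ub_le_sup => //; exists n.+1 => //=.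
have -> : limn_sup u = inf (range (sups u)) by exact: cvg_lim (cvg_sups_inf ubr lbr).
split.
  apply: lt_le_trans pb0 _; apply: lb_le_inf; first by exists (sups u 0); exists 0%N.
  by move=> _ [n _ <-].
move=> t t0 tu.
(* The tail starts at [1] because [u 0] is a power with exponent [0] and carries no information. *)
have t1 : t < sups u 1.
  apply: lt_le_trans tu _; apply: ge_inf; last by exists 1%N.
  by exists (p b) => _ [n _ <-].
have [_ [k /= k1 <-] tk] : exists2 z, sdrop u 1 z & t < z.
  by apply: sup_gt => //; exists (u 1); exists 1%N => /=.
have tS : t ^+ k < sup (S k) by exact: (lt_powR_root t0 (supS0 k) k1 tk).
have [_ [s [sk sm] <-] ts] := sup_gt (ex_intro _ _ (Sne k)) tS.
by exists s => //; rewrite sk.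
Qed.

End Blocks.

(** * Scaling of the mass at occurrences of the barrier digit *)

Section BarrierScaling.
Variables (R : realType) (d m b : nat) (p : nat -> R) (mu : probability R R).
Hypothesis hd : (3 <= d)%N.
Hypothesis hm : (d <= m)%N.
Hypothesis hcpt : compactly_supported mu.
Hypothesis hss : self_similar d m p mu.
Hypothesis hb1 : (b.+2 <= d)%N.
Hypothesis hb2 : (m.+2 <= b + d)%N.

Local Notation T := (transfer d m p 1).
Local Notation Tw := (transfer_word d m p 1).
Local Notation digits := (all (fun i => i <= m)%N).

Definition mass_row (X r : R) : 'rV[R]_(1.*2.+1) :=
  \row_l mass mu (X - (l%:Z - 1%:Z)%:~R) r.

Let d1 : 1 < d%:R :> R. Proof. by rewrite ltr1n ltnW. Qed.
Let mass0 := mass_outside hd hcpt hss.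

(* The truncation to offsets [-1, 0, 1] loses nothing: since [xi < 2], balls of
   radius [< 2 - xi] around points at offset [>= 2] miss the support. *)
Lemma mass_row_step (X X' r : R) (w : nat) :
    (w <= m)%N -> 0 <= X' <= xi R d m -> d%:R * X = w%:R + X' ->
    d%:R * r < 2 - xi R d m ->
  mass_row X r = mass_row X' (d%:R * r) *m T w.
Proof.
move=> wm /andP[X0 X1] XE rs; apply/rowP => l.
pose f (z : int) := mass mu (X' - z%:~R) (d%:R * r).
have fE z : f z = \sum_(k < 1.*2.+1) f (k%:Z - 1%:Z) * (z == k%:Z - 1%:Z)%:R.
  have [zb|zb] := boolP ((-1 <= z) && (z <= 1)).
    have k3 : (`|(z + 1)%R|%N < 1.*2.+1)%N by rewrite /=; lia.
    rewrite (bigD1 (Ordinal k3)) //= big1 ?addr0 => [|k kk].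
      have <- : z = `|(z + 1)%R|%N%:Z - 1%:Z by lia.
      by rewrite eqxx mulr1.
    case: eqP => [zk|]; last by rewrite mulr0.
    by case/eqP: kk; apply: val_inj => /=; lia.
  rewrite big1 => [|k _]; last first.
    case: eqP => [zk|]; last by rewrite mulr0.
    by move: zb; rewrite zk; have : (k < 3)%N := ltn_ord k; lia.
  apply: mass0.
  have [z2|z2] : (2 <= z)%R \/ (z <= - 2)%R by lia.
    left; have : (2 : R) <= z%:~R by rewrite -[2]/((2%:Z)%:~R) ler_int.
    by lra.
  right; have : (z%:~R : R) <= - 2 by rewrite -[2]/((2%:Z)%:~R) -rmorphN ler_int.
  by lra.
rewrite mxE (mass_self_similar hd hss) [RHS]mxE.
under [RHS]eq_bigr do rewrite mxE [T w _ _]mxE pz_sum mulr_sumr.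
rewrite exchange_big /=; apply: eq_bigr => i _.
move: (l%:Z - 1%:Z) => e.
(* Digit [i] sends offset [e] to [i - w + e d]; this equals [k] exactly when [i = k + w - e d], the
   index of [p] in the entry of [T w]. *)
have -> : mass mu (d%:R * (X - e%:~R) - i%:R) (d%:R * r)
        = f (i%:Z - w%:Z + e * d%:Z).
  by rewrite /f mulrBr XE !(rmorphD, rmorphN, rmorphM) /= -!pmulrn; congr mass; ring.
rewrite fE mulr_sumr; apply: eq_bigr => k _.
rewrite mulrCA; congr (_ * (_ * _)).
by move: (e * d%:Z) => z; congr (nat_of_bool _)%:R; apply/eqP/eqP; lia.
Qed.

Variables (w : nat -> nat) (X : nat -> R).
Hypothesis wm : forall n, (w n <= m)%N.
Hypothesis X01 : forall n, 0 <= X n <= xi R d m.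
Hypothesis XE : forall n, d%:R * X n = (w n)%:R + X n.+1.

Lemma mass_row_iter n (r : R) : 0 < r -> d%:R ^+ n * r < 2 - xi R d m ->
  mass_row (X 0) r = mass_row (X n) (d%:R ^+ n * r) *m Tw (mkseq w n).
Proof.
move=> r0; elim: n => [|n IH] rs.
  by rewrite expr0 mul1r /transfer_word big_nil mulmx1.
have d0 : 0 < d%:R ^+ n * r by rewrite mulr_gt0 // exprn_gt0 // (lt_trans _ d1).
rewrite mkseqS -cats1 transfer_word_cat transfer_word1 mulmxA exprS -mulrA.
rewrite -(@mass_row_step (X n)) //; last by rewrite mulrA -exprS.
apply: IH; apply: le_lt_trans rs; rewrite exprS -mulrA.
by rewrite -[leLHS]mul1r ler_wpM2r // ltW.
Qed.

(** As [w n = b], the point [d X n] lies in [[b, b + xi]]. With [d s < 2 - xi] for the rescaled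
    radius [s], the bounds on [b] push the balls around [X n - 1] and [X n + 1] off [[0, xi]], so
    only the middle coordinate of the row survives. *)
Lemma mass_barrier n (r : R) : w n = b -> 0 < r ->
    d%:R ^+ n * r < (2 - xi R d m) / d%:R ->
  mass mu (X 0) r = mass mu (X n) (d%:R ^+ n * r) * Tw (mkseq w n) mid mid.
Proof.
move=> wn r0; have d0 : 0 < d%:R :> R by have := d1; lra.
set s := _ * r; rewrite ltr_pdivlMr // => sd.
have gap : 0 < 2 - xi R d m by rewrite subr_gt0 (@xi_lt2 R d m b).
have s0 : 0 < s by rewrite mulr_gt0 // exprn_gt0.
have s2 : s < 2 - xi R d m.
  by apply: lt_trans sd; rewrite -[ltLHS]mulr1 ltr_pM2l.
have := congr1 (fun A : 'rV_(1.*2.+1) => A 0 mid) (mass_row_iter r0 s2).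
rewrite mxE subrr subr0 -/s => ->; rewrite mxE (bigD1 mid) //= mxE subrr subr0.
rewrite big1 ?addr0 // => k kmid; rewrite mxE mass0 ?mul0r //.
clearbody s.
have := XE n; rewrite wn => Xn.
have /andP[Xn0 Xn1] := X01 n.+1.
have b1 : b%:R + 2 <= d%:R :> R by rewrite -natrD ler_nat addn2.
have b2 : m%:R + 2 <= b%:R + d%:R :> R by rewrite -!natrD ler_nat addn2.
have xiE := xi_fixpoint R m hd.
have k02 : k = 0%N :> nat \/ k = 2%N :> nat.
  case: k kmid => [[|[|[|k]]] Hk] //=; by [left|right].
case: k02 => ->.
  right; have -> : ((0%:Z - 1%:Z)%:~R : R) = -1 by [].
  by rewrite -(ltr_pM2l d0); nra.
left; have -> : ((2%:Z - 1%:Z)%:~R : R) = 1 by [].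
by rewrite -(ltr_pM2l d0); nra.
Qed.

End BarrierScaling.

(** * Greedy concatenation of light and heavy blocks *)

Section Greedy.
Variables (R : realType) (d m b : nat) (p : nat -> R) (t : R) (s1 s2 : seq nat).
Hypothesis hd : (3 <= d)%N.
Hypothesis hm : (d <= m)%N.
Hypothesis hpos : forall i, (i <= m)%N -> 0 < p i.
Hypothesis hb1 : (b.+2 <= d)%N.
Hypothesis hb2 : (m.+2 <= b + d)%N.
Hypothesis t0 : 0 < t.

Local Notation Tw := (transfer_word d m p 1).
Local Notation digits := (all (fun i => i <= m)%N).

Hypothesis s1m : digits s1.
Hypothesis s2m : digits s2.
Hypothesis s1t : Tw (b :: s1) mid mid < t ^+ (size s1).+1.
Hypothesis s2t : t ^+ (size s2).+1 < Tw (b :: s2) mid mid.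

Definition weight_ratio (s : seq nat) : R := Tw s mid mid / t ^+ size s.

(* Appending a light block when the ratio is [>= 1] and a heavy one otherwise
   keeps it between two positive constants. *)
Definition greedy_block (s : seq nat) : seq nat :=
  b :: (if 1 <= weight_ratio s then s1 else s2).

Fixpoint greedy (j : nat) : seq nat :=
  if j is j'.+1 then greedy j' ++ greedy_block (greedy j') else [::].

(** Each step appends at least the letter [b], so [greedy i.+1] is long enough and the default of
    [nth] never occurs. *)
Definition greedy_seq (i : nat) : nat := nth 0 (greedy i.+1) i.

Lemma greedy_digits j : digits (greedy j).
Proof.
elim: j => [|j IH] //=; rewrite all_cat IH /=.
apply/andP; split; first exact: leq_trans (ltnW (ltnW hb1)) hm.
by case: ifP.
Qed.

Lemma greedy_size_bounds j :
  (size (greedy j) < size (greedy j.+1)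
     <= size (greedy j) + (maxn (size s1) (size s2)).+1)%N.
Proof. rewrite /= size_cat /= -[X in (X < _)%N]addn0 ltn_add2l leq_add2l /= !ltnS.
by case: ifP => _; rewrite ?leq_maxl ?leq_maxr. Qed.

(** The ratio starts at [1] and is multiplicative over blocks. From a value at least [1] it is
    lowered by the light factor, from a value below [1] raised by the heavy one, so it never leaves
    the interval between these factors. *)
Lemma greedy_weight_ratio j :
  weight_ratio (b :: s1) <= weight_ratio (greedy j) <= weight_ratio (b :: s2).
Proof.
have tX k : 0 < t ^+ k by exact: exprn_gt0.
have digits_b s : digits s -> digits (b :: s).
  by move=> /= ->; rewrite andbT (leq_trans (ltnW (ltnW hb1)) hm).
have r1 : weight_ratio (b :: s1) < 1 by rewrite ltr_pdivrMr // mul1r.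
have r2 : 1 < weight_ratio (b :: s2) by rewrite ltr_pdivlMr // mul1r.
have ratio0 s : digits s -> 0 < weight_ratio s.
  by move=> sm; rewrite divr_gt0 // transfer_word_mid_gt0.
have r10 := ratio0 _ (digits_b _ s1m).
elim: j => [|j /andP[IH1 IH2]].
  rewrite /weight_ratio /= /transfer_word big_nil mxE eqxx divr1.
  by rewrite -!/(weight_ratio _) !ltW.
have g0 := ratio0 _ (greedy_digits j).
have catE s : weight_ratio (greedy j ++ b :: s)
            = weight_ratio (b :: s) * weight_ratio (greedy j).
  rewrite /weight_ratio transfer_word_cat_barrier // size_cat exprD invfM.
  by rewrite [_^-1 * _]mulrC mulrACA.
rewrite /= /greedy_block; case: ifPn => [g1|]; rewrite catE.
  rewrite ler_peMr ?(ltW r10) //=; apply: le_trans IH2.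
  by rewrite ler_piMl // ltW.
rewrite -ltNge => g1; apply/andP; split.
  by apply: le_trans IH1 _; rewrite ler_peMl // ltW.
by rewrite ler_piMr // ltW // (lt_trans _ r2).
Qed.

Lemma greedy_prefix j k i : (j <= k)%N -> (i < size (greedy j))%N ->
  nth 0 (greedy k) i = nth 0 (greedy j) i.
Proof.
move=> /subnK <- ij; elim: (k - j)%N => [|l IH] //.
rewrite addSn /= nth_cat ifT //; apply: leq_trans ij _.
elim: (l) => [|l' IH'] //; rewrite addSn /= size_cat.
exact: leq_trans IH' (leq_addr _ _).
Qed.

Lemma leq_size_greedy j : (j <= size (greedy j))%N.
Proof.
elim: j => [|j IH] //; apply: leq_ltn_trans IH _.
by have /andP[] := greedy_size_bounds j.
Qed.

Lemma greedy_seqE j i : (i < size (greedy j))%N ->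
  greedy_seq i = nth 0 (greedy j) i.
Proof.
move=> ij; have [ji|ji] := leqP j i.+1; first exact: greedy_prefix.
by apply/esym/greedy_prefix; [exact: ltnW | exact: leq_size_greedy].
Qed.

Lemma mkseq_greedy_seq j : mkseq greedy_seq (size (greedy j)) = greedy j.
Proof.
apply: (@eq_from_nth _ 0%N); rewrite size_mkseq // => i ij.
by rewrite nth_mkseq // (greedy_seqE ij).
Qed.

Lemma greedy_seq_barrier j : greedy_seq (size (greedy j)) = b.
Proof.
rewrite (@greedy_seqE j.+1); last by have /andP[] := greedy_size_bounds j.
by rewrite /= nth_cat ltnn subnn.
Qed.

Lemma greedy_seq_le i : (greedy_seq i <= m)%N.
Proof.
have /all_nthP := greedy_digits i.+1; apply; exact: leq_size_greedy.
Qed.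

End Greedy.

Lemma barrier_words_inner (d m b : nat) : (3 <= d)%N -> (d <= m)%N ->
  (b.+2 <= d)%N -> (m.+2 <= b + d)%N -> words_inner m [:: b].
Proof.
by move=> hd hm hb1 hb2; rewrite /words_inner /= andbT; split=> //; lia.
Qed.

(** * Dimensions at the endpoints and in the open interval *)

Section Conclusion.
Variables (R : realType) (d m : nat) (p : nat -> R) (mu : probability R R).
Hypothesis hd : (3 <= d)%N.
Hypothesis hm : (d <= m)%N.
Hypothesis hpos : forall i, (i <= m)%N -> 0 < p i.
Hypothesis hcpt : compactly_supported mu.
Hypothesis hss : self_similar d m p mu.

Let d1 : 1 < d%:R :> R. Proof. by rewrite ltr1n ltnW. Qed.
Let lnd : 0 < ln d%:R :> R. Proof. by rewrite ln_gt0. Qed.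

Lemma delta_ln_lt (x y : R) : 0 < x -> 0 < y ->
  delta R d * ln x < delta R d * ln y -> y < x.
Proof.
move=> x0 y0; rewrite ltr_nM2l; last by rewrite /delta oppr_lt0 invr_gt0.
by rewrite ltr_ln ?posrE.
Qed.

(** The point [c] is fixed by the map of [i0], and the gap condition lets all other digits send
    small balls off the support. Each rescaling by [d] thus multiplies the mass by exactly
    [p i0]. *)
Lemma Delta_fixed_digit (c : R) (i0 : nat) :
    (i0 <= m)%N -> 0 <= c <= xi R d m -> d%:R * c = i0%:R + c ->
    (forall i, (i <= m)%N -> i != i0 ->
       d%:R * c - i%:R + 1 <= 0 \/ xi R d m <= d%:R * c - i%:R - 1) ->
  Delta mu (delta R d * ln (p i0)).
Proof.
move=> i0m c01 cE gap.
have HY r : 0 < r -> exists2 k : R, 0 < k & forall j : nat, k <= mass mu c r.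
  move=> r0; have [k k0 Hk] := mass_lower_bound hd hpos hcpt hss r0.
  exists k => // j.
  exact: (Hk (fun=> i0) (fun=> c) (fun=> i0m) (fun=> c01) (fun=> cE) 0).
have step s : d%:R * s < 1 -> mass mu c s = p i0 * mass mu c (d%:R * s).
  move=> s1; rewrite (mass_self_similar hd hss).
  rewrite (bigD1 (inord i0)) //= inordK ?ltnS // big1 ?addr0 => [|i ii0].
    by rewrite cE addrC addKr.
  rewrite (mass_outside hd hcpt hss) ?mulr0 //.
  have im : (i <= m)%N by rewrite -ltnS.
  have ne : i != i0 :> nat.
    by apply: contra ii0 => /eqP e; rewrite -val_eqE /= inordK ?ltnS // e.
  by case: (gap i im ne) => H; [left|right]; lra.
exists c.
  apply: supp_mass => r r0; have [k k0 Hk] := HY r r0.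
  exact: lt_le_trans k0 (Hk 0).
apply: (@locdim_of_scaling R d mu hd c _ 1 1 1 1 (fun=> c) (fun=> 1) id) => //.
- by move=> j; rewrite lexx.
- by move=> j; rewrite addn1 !leqnn.
have -> : - (delta R d * ln (p i0)) * ln d%:R = ln (p i0).
  by rewrite /delta; field; rewrite gt_eqF.
move=> j r r0; rewrite mulr1 expRM_natr lnK ?posrE ?hpos //.
elim: j => [|j IH] H; first by rewrite !expr0 mul1r mulr1.
have dj : 0 < d%:R ^+ j * r by rewrite mulr_gt0 // exprn_gt0 //; have := d1; lra.
rewrite IH; last first.
  apply: le_lt_trans H; rewrite exprS -mulrA -[leLHS]mul1r ler_wpM2r // ltW //.
rewrite step; last by rewrite mulrA -exprS.
by rewrite mulrA -exprS (exprSr (p i0)); ring.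
Qed.

Hypothesis hsum : \sum_(i < m.+1) p i = 1.

Lemma heavy_block_of_alpha_low (b : nat) (t : R) :
    (b.+2 <= d)%N -> (m.+2 <= b + d)%N -> 0 < t ->
    alpha_low d m p < delta R d * ln t ->
  exists2 s, all (fun i => i <= m)%N s &
    t ^+ (size s).+1 < transfer_word d m p 1 (b :: s) mid mid.
Proof.
move=> hb1 hb2 t0.
have [rho0 Hrho] := gen_specrad_barrier hd hm hpos hsum hb1 hb2.
move=> /(delta_ln_lt rho0 t0) /(Hrho t t0) [u um ut].
exact: exists_heavy_block ut.
Qed.

Lemma light_block_of_alpha_star (b : nat) (t : R) :
    (b.+2 <= d)%N -> (m.+2 <= b + d)%N -> 0 < t ->
    delta R d * ln t < alpha_star d m p ->
  exists2 s, all (fun i => i <= m)%N s &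
    transfer_word d m p 1 (b :: s) mid mid < t ^+ (size s).+1.
Proof.
move=> hb1 hb2 t0.
pose S := [set (specrad (transfer_word d m p 1 s)) `^ ((size s)%:R^-1)
             | s in words_inner m].
have SE : alpha_star d m p = delta R d * ln (inf S).
  have -> : alpha_star d m p = delta R d * ln (inf
    [set (specrad (transfer_word d m p (adim d m) s)) `^ ((size s)%:R^-1)
       | s in words_inner m]) by [].
  by rewrite (adim_barrier hd hm hb1 hb2).
have Sne : S !=set0.
  by eexists; exists [:: b]; [exact: barrier_words_inner hd hm hb1 hb2|reflexivity].
rewrite SE => astar.
have S_t : inf S < t.
  (* The logarithm only compares positive numbers; a nonpositive infimum is below [t] anyway. *)
  have [S0|S0] := leP (inf S) 0; first exact: le_lt_trans t0.
  exact: (delta_ln_lt t0 S0).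
have [_ [u [u0 [um _]] <-] ut] := inf_lt Sne S_t.
apply: (exists_light_block b hpos hsum t0 um).
exact: (powR_root_lt t0 u0 ut).
Qed.

Lemma Delta_barrier (b : nat) (alpha : R) :
    (b.+2 <= d)%N -> (m.+2 <= b + d)%N ->
    alpha_low d m p < alpha -> alpha < alpha_star d m p ->
  Delta mu alpha.
Proof.
move=> hb1 hb2.
have [t t0 <-] : exists2 t, 0 < t & delta R d * ln t = alpha.
  (* This is [t = d^(-alpha)]. *)
  exists (expR (- alpha * ln d%:R)); first exact: expR_gt0.
  by rewrite expRK /delta; field; rewrite gt_eqF.
move=> /(heavy_block_of_alpha_low hb1 hb2 t0) [s2 s2m s2t].
move=> /(light_block_of_alpha_star hb1 hb2 t0) [s1 s1m s1t].
pose w := greedy_seq d m b p t s1 s2.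
have wm : forall n, (w n <= m)%N by move=> n; exact: greedy_seq_le.
pose X n := pi_inf R d (fun i => w (n + i)%N).
have X01 n : 0 <= X n <= xi R d m by exact: pi_inf_le_xi.
have XE n : d%:R * X n = (w n)%:R + X n.+1.
  rewrite /X (@pi_inf_rec R d m hd) // addn0; congr (_ + pi_inf R d _).
  by apply/funext => i; rewrite addSnnS.
pose g := greedy d m b p t s1 s2.
have HY r : 0 < r -> exists2 k : R, 0 < k & forall n, k <= mass mu (X n) r.
  move=> r0; have [k k0 Hk] := mass_lower_bound hd hpos hcpt hss r0.
  by exists k => // n; exact: (Hk w X wm X01 XE n).
exists (X 0).
  apply: supp_mass => r r0; have [k k0 Hk] := HY r r0.
  exact: lt_le_trans k0 (Hk 0).
have gap : 0 < (2 - xi R d m) / d%:R.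
  by rewrite divr_gt0 //; [rewrite subr_gt0 (@xi_lt2 R d m b) | have := d1; lra].
have r1 : 0 < weight_ratio d m p t (b :: s1).
  rewrite divr_gt0 ?exprn_gt0 //.
  apply: transfer_word_mid_gt0 => //=.
  by rewrite s1m andbT (leq_trans (ltnW (ltnW hb1)) hm).
(* The scales are the lengths of the greedy words: there the next digit is [b], so [mass_barrier]
   applies, and [Q] is the bounded weight ratio. *)
apply: (@locdim_of_scaling R d mu hd (X 0) (delta R d * ln t) _ _
  (weight_ratio d m p t (b :: s2)) (maxn (size s1) (size s2)).+1
  (fun j => X (size (g j))) (fun j => weight_ratio d m p t (g j))
  (fun j => size (g j)) gap r1).
- by move=> j; exact: greedy_weight_ratio.
- by [].
- by move=> j; exact: greedy_size_bounds.
- by move=> r r0; have [k k0 Hk] := HY r r0; exists k.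
move=> j r r0 rj.
have wb : w (size (g j)) = b by exact: greedy_seq_barrier.
rewrite (mass_barrier hd hm hcpt hss hb1 hb2 wm X01 XE wb r0 rj).
rewrite mkseq_greedy_seq -/g; congr (_ * _).
have -> : - (delta R d * ln t) * ln d%:R = ln t.
  by rewrite /delta; field; rewrite gt_eqF.
rewrite expRM_natr lnK ?posrE // /weight_ratio; field.
by rewrite gt_eqF // exprn_gt0.
Qed.

End Conclusion.

Theorem theorem3 (R : realType) (d m : nat) (p : nat -> R)
  (hd : (3 <= d)%N) (hm : (d <= m)%N)
  (hpos : forall i, (i <= m)%N -> 0 < p i)
  (hsum : \sum_(i < m.+1) p i = 1)
  (hreg0 : p 0%N <= p m)
  (hreg : forall i, (1 <= i <= m.-1)%N -> p m <= p i)
  (mu : probability R R)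
  (hcpt : compactly_supported mu)
  (hss : self_similar d m p mu)
  (hbar : exists b, barrier_digit R d m b) :
  [set alpha | alpha_low d m p < alpha < alpha_star d m p]
    `|` [set delta R d * ln (p m)]
    `|` [set alpha_up d p]
  `<=` Delta mu.
Proof.
have xiE := xi_fixpoint R m hd; have xi0 := xi_ge0 R m hd.
move=> alpha [[/= /andP[alow astar]|->]|->].
- have [b /(barrier_digit_bounds hd hm)[hb1 hb2]] := hbar.
  exact: (Delta_barrier hd hm hpos hcpt hss hsum hb1 hb2).
(* The endpoint [xi] is fixed by the digit [m]; a digit [i < m] moves it to at least [xi + 1]. *)
- apply: (@Delta_fixed_digit R d m p mu hd hpos hcpt hss (xi R d m)) => //.
    by rewrite xi0 lexx.
  move=> i im ine; right; have : i.+1%:R <= m%:R :> R.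
    by rewrite ler_nat ltn_neqAle ine.
  by rewrite -natr1 xiE; lra.
(* The endpoint [0] is fixed by the digit [0]; a digit [i >= 1] moves it to at most [-1]. *)
- apply: (@Delta_fixed_digit R d m p mu hd hpos hcpt hss 0) => //.
  + by rewrite lexx.
  + by rewrite mulr0 add0r.
  + move=> i im i0; left; have : 1 <= i%:R :> R by rewrite ler1n lt0n.
    by rewrite mulr0; lra.
Qed.
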